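(* Let $s\geq 9$ and let $\mathbb{X}\subset \mathbb{P}^2_k$ be an $(s-3)$-fold collinear configuration of $s$ distinct points. Suppose, moreover, that the remaining three points (those off the line containing exactly $s-3$ points of $\mathbb{X}$) are in general linear position. Then the Jacobian ideal of $I(\mathbb{X})$ is not $\mathcal{VV}$-torsion free.
   Context: $k$ is an algebraically closed field of characteristic zero and $R=k[x,y,z]$ is the homogeneous coordinate ring of $\mathbb{P}^2_k$. Configuration: given integers $s\geq 4$ and $0\leq r\leq s-3$, an $(s-r)$-fold collinear configuration is a set of $s$ distinct points of $\mathbb{P}^2_k$ such that exactly $s-r$ of them lie on a straight line (i.e. there is a line containing exactly $s-r$ of the points). A finite set of at least $3$ distinct points in $\mathbb{P}^2_k$ is in general linear position if no three of them lie on a line. For a finite set $\mathbb{X}$ of distinct points, $J=I(\mathbb{X})\subset R$ is its (radical) homogeneous defining ideal. Let $\Theta$ be the Jacobian matrix of a set of homogeneous generators of $J$, and $I_2(\Theta)\subset R$ the ideal generated by its $2\times 2$ minors. Put $I=(J,I_2(\Theta))\subset R$; the Jacobian ideal of $I(\mathbb{X})$ is $I$ (equivalently its image $I/J$ in $R/J$); it does not depend on the choice of generators. The Jacobian ideal is called $\mathcal{VV}$-torsion free if the Valabrega--Valla module $\bigoplus_{t\ge 2}\frac{J\cap I^t}{J I^{t-1}}$ is zero, i.e. if $J\cap I^t=JI^{t-1}$ for all $t\geq 2$. *)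

(* Defs.v *)
From HB Require Import structures.
From mathcomp Require Import all_boot all_order all_algebra.
From mathcomp Require Import finmap mpoly.

Set Implicit Arguments.
Unset Strict Implicit.
Unset Printing Implicit Defensive.

Import GRing.Theory.
Local Open Scope ring_scope.

(* Ideals are Prop-valued predicates, since ideals of {mpoly k[3]} given by
   generators or intersections are not decidable a priori. *)
Section Ideals.

Variable A : comNzRingType.
Implicit Types (S I J : A -> Prop).

Definition ideal_gen S : A -> Prop := fun f =>
  exists (n : nat) (a b : 'I_n -> A),
    (forall i, S (b i)) /\ f = \sum_(i < n) a i * b i.

Definition ideal_mul I J : A -> Prop :=
  ideal_gen (fun f => exists a b, [/\ I a, J b & f = a * b]).

Fixpoint ideal_exp I (t : nat) : A -> Prop :=
  if t is u.+1 then ideal_mul I (ideal_exp I u) else fun=> True.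

(* The 2 x 2 minors of M; repeated or permuted row and column indices only add
   zeros and opposites of minors. *)
Definition minor2 m n (M : 'M[A]_(m, n)) : A -> Prop := fun f =>
  exists (r : 'I_2 -> 'I_m) (c : 'I_2 -> 'I_n), f = \det (mxsub r c M).

(* The Valabrega-Valla module is zero exactly when all its summands
   (J :&: I^t) / (J I^(t-1)), t >= 2, are. *)
Definition VV_torsion_free J I : Prop :=
  forall t : nat, (2 <= t)%N ->
  forall f : A, (J f /\ ideal_exp I t f) <-> ideal_mul J (ideal_exp I t.-1) f.

End Ideals.

(* Points (lines) of the projective plane over k are the 1-dimensional
   (2-dimensional) linear subspaces of k^3; incidence is inclusion. *)
Notation proj_point k := {P : {vspace 'rV[k]_3} | \dim P == 1%N}.
Notation proj_line k := {L : {vspace 'rV[k]_3} | \dim L == 2%N}.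

Section Plane.

Variable k : fieldType.
Implicit Types (X : {fset proj_point k}) (J : {mpoly k[3]} -> Prop).

Definition on_line (P : proj_point k) (L : proj_line k) : bool :=
  (val P <= val L)%VS.

Definition points_on X (L : proj_line k) : {fset proj_point k} :=
  [fset P in X | on_line P L]%fset.

Definition points_off X (L : proj_line k) : {fset proj_point k} :=
  [fset P in X | ~~ on_line P L]%fset.

Definition collinear_configuration (s r : nat) X (L : proj_line k) : Prop :=
  [/\ (4 <= s)%N, (r <= s - 3)%N, #|` X|%fset = s &
      #|` points_on X L|%fset = (s - r)%N].

Definition general_linear_position X : Prop :=
  (3 <= #|` X|%fset)%N /\
  forall P Q T, P \in X -> Q \in X -> T \in X ->
    P != Q -> P != T -> Q != T ->
    forall L : proj_line k, ~ [/\ on_line P L, on_line Q L & on_line T L].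

Definition vanishes_at (f : {mpoly k[3]}) (P : proj_point k) : Prop :=
  forall v : 'rV[k]_3, v \in val P -> f.@[fun i => v 0 i] = 0.

Definition defining_ideal X : {mpoly k[3]} -> Prop :=
  ideal_gen (fun f => (exists d : nat, f \is d.-homog) /\
                      forall P, P \in X -> vanishes_at f P).

Definition homogeneous_generators J (m : nat) (g : m.-tuple {mpoly k[3]}) :
    Prop :=
  (forall i, exists d : nat, tnth g i \is d.-homog) /\
  forall f, J f <-> ideal_gen (fun h => h \in g) f.

Definition jacobian_mx (m : nat) (g : m.-tuple {mpoly k[3]}) :
    'M[{mpoly k[3]}]_(m, 3) :=
  \matrix_(i < m, j < 3) (tnth g i)^`M(j).

(* Up to equality of ideals this is independent of the choice of homogeneous
   generators g of J. *)
Definition jacobian_ideal J (m : nat) (g : m.-tuple {mpoly k[3]}) :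
    {mpoly k[3]} -> Prop :=
  ideal_gen (fun f => J f \/ minor2 (jacobian_mx g) f).

End Plane.

(* Main.v *)
Require Import Defs.
From HB Require Import structures.
From mathcomp Require Import all_boot all_order all_algebra.
From mathcomp Require Import finmap mpoly.
From mathcomp Require Import ring zify.

Set Implicit Arguments.
Unset Strict Implicit.
Unset Printing Implicit Defensive.

Import GRing.Theory.
Local Open Scope ring_scope.

(** Let [l] be an equation of the line, [u, v, l] linear coordinates, and let
    [J] and [I] be the ideal of the points and its Jacobian ideal. The n = s - 3
    >= 6 points on the line are the zeros of a squarefree binary form f(u, v) of
    degree n, and the other three are the vertices of a triangle. Write f1, f2,
    f11, f12, f22 for the derivatives of [f] along the line.

    Modulo [l], every element of [J] is a multiple of [f] ([J_on_line]), and
    every element of [I] lies in (f1, f2), because a 2 x 2 minor of gradients of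
    elements a f + b l is, modulo f1, f2 and l, a minor of multiples of the
    gradient of [l] ([I_on_line]). So modulo [l] the product J I lies in f (f1,
    f2).

    In the other direction [I] contains l t for all forms [t] of degree at least
    3 ([line_multiple_in]) and q f1, q f2 for all quadratic forms [q]
    ([quadric_dird_in]). As n - 2 >= 4, each second derivative of [f] is a
    combination of products of two quadratic forms, so
       W = f22 f1^2 - 2 f12 f1 f2 + f11 f2^2
    lies in I^2 ([polar_hessian_in_square]). It vanishes on the line at the n
    points, and subtracting a suitable element l^2 t of I^2 makes it vanish at
    the three vertices as well: this gives an element of J and of I^2 that is
    congruent to W modulo [l].

    By Euler's relation W = n / (n - 1) f H, where H = f11 f22 - f12^2 is the
    Hessian of [f]. If that element were in J I, then H would be in (f1, f2)
    modulo [l]. This is impossible in characteristic zero, because H generates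
    the socle of k[u, v] / (f1, f2); a direct interpolation argument at the n
    zeros of [f] proves it ([polar_hessian_not_in_product]). Hence J I and the
    intersection of [J] with I^2 differ. *)

(** * Ideals *)

Section IdealPredicates.

Variable A : comNzRingType.
Implicit Types (I K : A -> Prop) (S : A -> Prop).

Definition is_ideal I : Prop :=
  [/\ I 0, forall p q, I p -> I q -> I (p + q) & forall a p, I p -> I (a * p)].

Lemma ideal_sum I (T : Type) (r : seq T) (F : T -> A) :
  is_ideal I -> (forall i, I (F i)) -> I (\sum_(i <- r) F i).
Proof. by case=> I0 ID _ IF; apply: (big_ind I) => // i _; exact: IF. Qed.

Lemma ideal_opp I p : is_ideal I -> I p -> I (- p).
Proof. by case=> _ _ IM Ip; rewrite -mulN1r; apply: IM. Qed.

Lemma ideal_sub I p q : is_ideal I -> I p -> I q -> I (p - q).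
Proof.
by move=> idI Ip Iq; case: (idI) => _ ID _; apply: ID => //; apply: ideal_opp.
Qed.

Lemma ideal_mulr I a p : is_ideal I -> I p -> I (p * a).
Proof. by case=> _ _ IM Ip; rewrite mulrC; apply: IM. Qed.

Lemma ideal_gen_sub I S :
  is_ideal I -> (forall p, S p -> I p) -> forall p, ideal_gen S p -> I p.
Proof.
move=> idI SI p [n [a [b [Sb ->]]]]; apply: ideal_sum => // i.
by case: idI => _ _; apply; apply: SI.
Qed.

Lemma ideal_gen_mem S p : S p -> ideal_gen S p.
Proof.
by move=> Sp; exists 1%N, (fun=> 1), (fun=> p); rewrite big_ord1 mul1r.
Qed.

Lemma ideal_gen_ideal S : is_ideal (ideal_gen S).
Proof.
split=> [|p q|c p].
- by exists 0%N, (fun=> 0), (fun=> 0); split=> [[]|]; rewrite ?big_ord0.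
- move=> [n [a [b [Sb ->]]]] [n' [a' [b' [Sb' ->]]]].
  pose glue (x : 'I_n -> A) (x' : 'I_n' -> A) i :=
    match split i with inl j => x j | inr j => x' j end.
  exists (n + n')%N, (glue a a'), (glue b b'); split.
    by move=> i; rewrite /glue; case: (split i).
  rewrite big_split_ord /=; congr (_ + _); apply: eq_bigr => i _.
    by rewrite /glue (unsplitK (inl i)).
  by rewrite /glue (unsplitK (inr i)).
- move=> [n [a [b [Sb ->]]]]; exists n, (fun i => c * a i), b; split=> //.
  by rewrite mulr_sumr; apply: eq_bigr => i _; rewrite mulrA.
Qed.

Lemma ideal_exp2_mem I p q : I p -> I q -> ideal_exp I 2 (p * q).
Proof.
move=> Ip Iq; apply: ideal_gen_mem; exists p, q; split=> //.
by apply: ideal_gen_mem; exists q, 1; split; rewrite ?mulr1.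
Qed.

(** [ideal_exp I 1] is the product of [I] and the unit ideal, so it contains
    nothing outside [I]. *)
Lemma ideal_mul_exp1_sub I J K :
  is_ideal I -> is_ideal K -> (forall p q, J p -> I q -> K (p * q)) ->
  forall p, ideal_mul J (ideal_exp I 1) p -> K p.
Proof.
move=> idI idK JIK; apply: ideal_gen_sub => // _ [a [b [Ja Ib ->]]].
apply: JIK => //; move: b Ib; apply: ideal_gen_sub => // _ [b [c [Ib _ ->]]].
exact: ideal_mulr.
Qed.

(** The ideals generated by two and by three elements, in the unfolded form in
    which the coefficients are available. *)
Definition span2 (x y p : A) : Prop := exists a b, p = a * x + b * y.
Definition span3 (x y z p : A) : Prop :=
  exists a b c, p = a * x + b * y + c * z.

Lemma span2_ideal x y : is_ideal (span2 x y).
Proof.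
split=> [|p q [a [b ->]] [a' [b' ->]]|c p [a [b ->]]].
- by exists 0, 0; ring.
- by exists (a + a'), (b + b'); ring.
- by exists (c * a), (c * b); ring.
Qed.

Lemma span3_ideal x y z : is_ideal (span3 x y z).
Proof.
split=> [|p q [a [b [c ->]]] [a' [b' [c' ->]]]|e p [a [b [c ->]]]].
- by exists 0, 0, 0; ring.
- by exists (a + a'), (b + b'), (c + c'); ring.
- by exists (e * a), (e * b), (e * c); ring.
Qed.

End IdealPredicates.

(** * Linear forms and directional derivatives *)

Section Forms.

Variable k : fieldType.
Local Notation R := {mpoly k[3]}.
Implicit Types (p q : R) (x y : 'rV[k]_3) (c : 'cV[k]_3) (E : 'M[k]_3).

Local Notation ev x := (meval (fun i => x 0 i)).

Definition linform c : R := \sum_j c j 0 *: 'X_j.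

Definition dird x p : R := \sum_j x 0 j *: p^`M(j).

(** The rows of an invertible [E] are a basis of k^3; these linear forms are its
    dual basis. *)
Definition dual_coord E i : R := linform (col i (invmx E)).

Lemma ev_linform x c : ev x (linform c) = (x *m c) 0 0.
Proof.
rewrite /linform raddf_sum mxE /=; apply: eq_bigr => j _.
by rewrite mevalZ mevalXU mulrC.
Qed.

Lemma mderiv_U (i j : 'I_3) : ('X_i : R)^`M(j) = (i == j)%:R%:MP.
Proof.
rewrite mderivX mnm1E; case: eqP => [->|_]; last by rewrite scale0r mpolyC0.
by rewrite -{1}[U_(j)%MM]add0m addmK mpolyX0 scale1r mpolyC1.
Qed.

Lemma dird_is_linear x : linear (dird x).
Proof.
move=> a p q; rewrite /dird scaler_sumr -big_split /=; apply: eq_bigr => j _.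
by rewrite mderivD mderivZ scalerDr !scalerA mulrC.
Qed.

HB.instance Definition _ x :=
  GRing.isLinear.Build k R R _ (dird x) (dird_is_linear x).

Lemma dirdD x p q : dird x (p + q) = dird x p + dird x q.
Proof. exact: (raddfD (dird x)). Qed.

Lemma dirdB x p q : dird x (p - q) = dird x p - dird x q.
Proof. exact: (raddfB (dird x)). Qed.

Lemma dirdZ x (a : k) p : dird x (a *: p) = a *: dird x p.
Proof. exact: (linearZZ (dird x)). Qed.

Lemma dirdM x p q : dird x (p * q) = dird x p * q + p * dird x q.
Proof.
rewrite /dird mulr_suml mulr_sumr -big_split /=; apply: eq_bigr => j _.
by rewrite mderivM scalerDr scalerAl scalerAr.
Qed.

Lemma dird_comm x y p : dird x (dird y p) = dird y (dird x p).
Proof.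
have E a b : dird a (dird b p) =
    \sum_i \sum_j (a 0 i * b 0 j) *: (p^`M(i))^`M(j).
  rewrite -[LHS]/(\sum_i a 0 i *: (dird b p)^`M(i)).
  apply: eq_bigr => i _; rewrite /dird (raddf_sum (mderiv i)) scaler_sumr /=.
  apply: eq_bigr => j _.
  by rewrite mderivZ scalerA mderiv_comm.
rewrite !E exchange_big /=; apply: eq_bigr => i _; apply: eq_bigr => j _.
by rewrite mulrC mderiv_comm.
Qed.

Lemma dirdC x (a : k) : dird x a%:MP = 0.
Proof. by rewrite /dird big1 // => j _; rewrite mderivC scaler0. Qed.

Lemma dird_linform x c : dird x (linform c) = ((x *m c) 0 0)%:MP.
Proof.
rewrite /dird mxE raddf_sum /=; apply: eq_bigr => j _.
rewrite /linform (raddf_sum (mderiv j)) (bigD1 j) //= big1 => [|i ij].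
  by rewrite mderivZ mderiv_U eqxx addr0 alg_mpolyC mpolyCM mul_mpolyC.
by rewrite mderivZ mderiv_U (negPf ij) mpolyC0 scaler0.
Qed.

Lemma linform_homog c : linform c \is 1.-homog.
Proof. by apply: rpred_sum => j _; apply: rpredZ; rewrite dhomogX /= mdeg1. Qed.

(** ** Homogeneous polynomials *)

Lemma dhomog_ind d (P : R -> Prop) :
    P 0 -> (forall p q, P p -> P q -> P (p + q)) ->
    (forall (a : k) m, mdeg m = d -> P (a *: 'X_[m])) ->
  forall p, p \is d.-homog -> P p.
Proof.
move=> P0 PD PX p /dhomogP hp; rewrite [p]mpolyE big_seq.
by apply: (big_ind P) => // m /hp; apply: PX.
Qed.

Lemma ev_scale d p (a : k) x :
  p \is d.-homog -> ev (a *: x) p = a ^+ d * ev x p.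
Proof.
move: p; apply: dhomog_ind => [|p q hp hq|b m <-].
- by rewrite !meval0 mulr0.
- by rewrite !mevalD hp hq mulrDr.
- rewrite !mevalZ !mevalX mulrCA; congr (_ * _).
  rewrite mdegE -prodrXr -big_split /=; apply: eq_bigr => i _.
  by rewrite mxE exprMn.
Qed.

Lemma mderiv_homog d p i : p \is d.-homog -> p^`M(i) \is d.-1.-homog.
Proof.
move: p; apply: dhomog_ind => [|p q hp hq|b m <-].
- by rewrite mderiv0 rpred0.
- by rewrite mderivD rpredD.
- rewrite mderivZ rpredZ // mderivX.
  have [->|mi] := eqVneq (m i) 0%N; first by rewrite scale0r rpred0.
  rewrite rpredZ // dhomogX /=.
  have {2}<- : (m - U_(i) + U_(i))%MM = m by rewrite submK // lep1mP.
  by rewrite mdegD mdeg1 addn1.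
Qed.

Lemma dird_homog d p x : p \is d.-homog -> dird x p \is d.-1.-homog.
Proof.
by move=> hp; apply: rpred_sum => i _; apply/rpredZ/mderiv_homog.
Qed.

Lemma euler_mderiv d p : p \is d.-homog -> \sum_i 'X_i * p^`M(i) = p *+ d.
Proof.
move: p; apply: dhomog_ind => [|p q hp hq|b m <-].
- by rewrite mul0rn big1 // => i _; rewrite mderiv0 mulr0.
- rewrite mulrnDl -hp -hq -big_split /=; apply: eq_bigr => i _.
  by rewrite mderivD mulrDr.
- rewrite mdegE -sumrMnr; apply: eq_bigr => i _.
  rewrite mderivZ -scalerAr mderivX -scalerAr.
  have [->|mi] := eqVneq (m i) 0%N; first by rewrite scale0r scaler0 mulr0n.
  rewrite -mpolyXD addmC submK ?lep1mP // scalerA mulr_natr scalerMnl.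
  by [].
Qed.

Lemma pihomogMl d e p q :
  p \is d.-homog -> pihomog mdeg (d + e) (p * q) = p * pihomog mdeg e q.
Proof.
move=> hp; elim/mpolyind: q => [|a m q _ _ IH].
  by rewrite mulr0 !pihomog0 mulr0.
rewrite mulrDr !pihomogD IH mulrDr -scalerAr !linearZ /= -scalerAr.
congr (_ *: _ + _); rewrite pihomogX; case: eqP => [<-|/eqP me].
  by rewrite pihomog_dE // dhomogM // dhomogX.
rewrite mulr0; apply: (@pihomog_ne0 _ _ _ (d + mdeg m)%N).
  by rewrite eqn_add2l.
by rewrite dhomogM // dhomogX.
Qed.

Lemma dhomog0_const p x : p \is 0.-homog -> p = (ev x p)%:MP.
Proof.
move: p; apply: dhomog_ind => [|p q {1}-> {1}->|a m /eqP].
- by rewrite meval0 mpolyC0.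
- by rewrite mevalD mpolyCD.
- rewrite mdeg_eq0 => /eqP ->.
  by rewrite mpolyX0 mevalZ meval1 mulr1 alg_mpolyC.
Qed.

(** ** Coordinates with respect to a basis *)

Lemma sum3 (V : nmodType) (F : 'I_3 -> V) :
  \sum_i F i = F 0 + F 1 + F ord_max.
Proof.
rewrite !big_ord_recr big_ord0 /= add0r.
by congr (F _ + F _ + F _); apply: val_inj.
Qed.

Variables (E : 'M[k]_3) (E_unit : E \in unitmx).

Lemma row_coord i j : row i E *m col j (invmx E) = (i == j)%:R%:M.
Proof.
apply/matrixP => a b; rewrite !ord1 [RHS]mxE mulr1n.
have /matrixP/(_ i j) := mulmxV E_unit; rewrite !mxE => <-.
by apply: eq_bigr => h _; rewrite !mxE.
Qed.

Lemma ev_coord i j : ev (row i E) (dual_coord E j) = (i == j)%:R.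
Proof. by rewrite ev_linform row_coord mxE mulr1n. Qed.

Lemma dird_coord i j : dird (row i E) (dual_coord E j) = (i == j)%:R%:MP.
Proof. by rewrite dird_linform row_coord mxE mulr1n. Qed.

Lemma coord_expand (j : 'I_3) : 'X_j = \sum_i E i j *: dual_coord E i :> R.
Proof.
have: \sum_i (E^T *m (invmx E)^T) j i *: 'X_i =
    \sum_i E i j *: dual_coord E i :> R.
  under eq_bigr => i _ do rewrite mxE scaler_suml.
  rewrite exchange_big; apply: eq_bigr => i _; rewrite /dual_coord /linform /=.
  rewrite scaler_sumr; apply: eq_bigr => m _.
  by rewrite !mxE scalerA.
move<-; rewrite -trmx_mul mulVmx // trmx1 (bigD1 j) //= big1 => [|i ij].
  by rewrite mxE eqxx scale1r addr0.
by rewrite mxE eq_sym (negPf ij) scale0r.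
Qed.

Lemma vec_expand x : x = \sum_i ev x (dual_coord E i) *: row i E.
Proof.
rewrite -{1}[x]mulmx1 -(mulVmx E_unit) mulmxA mulmx_sum_row.
apply: eq_bigr => i _; rewrite ev_linform; congr (_ *: _); rewrite !mxE.
by apply: eq_bigr => j _; rewrite mxE.
Qed.

Lemma euler d p :
  p \is d.-homog -> \sum_i dual_coord E i * dird (row i E) p = p *+ d.
Proof.
move/euler_mderiv => <-.
under [RHS]eq_bigr => j _ do rewrite coord_expand mulr_suml.
rewrite exchange_big; apply: eq_bigr => i _ /=.
rewrite /dird mulr_sumr; apply: eq_bigr => j _.
by rewrite mxE -scalerAl scalerAr.
Qed.

(** ** Binary forms on the line spanned by the first two basis vectors *)

Local Notation u := (dual_coord E 0).
Local Notation v := (dual_coord E 1).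
Local Notation l := (dual_coord E ord_max).

(** For a nonzero [x] on the line [l = 0] this is, up to scale and modulo [l],
    the only linear form that vanishes at [x]. *)
Definition rootform x : R := ev x v *: u - ev x u *: v.

(** The hypothesis says that modulo [I] the point of coordinates [X_j] is the
    multiple of [x] by [mu]; a form of degree [d] then takes the value of [p] at
    [x] times the [d]-th power of [mu]. *)
Lemma homog_congr (I : R -> Prop) x (mu : R) : is_ideal I ->
    (forall j, I ('X_j - x 0 j *: mu)) ->
  forall d p, p \is d.-homog -> I (p - ev x p *: mu ^+ d).
Proof.
move=> idI IX d; have [I0 ID IM] := idI.
have congrM a b a' b' : I (a - a') -> I (b - b') -> I (a * b - a' * b').
  move=> h h'; have -> : a * b - a' * b' = b * (a - a') + a' * (b - b') by ring.
  by apply: ID; apply: IM.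
apply: dhomog_ind => [|p q hp hq|a m <-].
- by rewrite meval0 scale0r subr0.
- by rewrite mevalD scalerDl opprD addrACA; apply: ID.
rewrite mevalZ -scalerA -scalerBr -(mul_mpolyC a); apply: IM.
rewrite mevalX mdegE -prodrXr -mul_mpolyC rmorph_prod -big_split /=.
rewrite mpolyXE_id.
elim/big_rec2: _ => [|i b c _ hbc]; first by rewrite subrr.
apply: (congrM) => //. rewrite rmorphXn -exprMn mul_mpolyC.
elim: (m i) => [|n IH]; first by rewrite !expr0 subrr.
by rewrite !exprS; apply: congrM.
Qed.

(** Modulo [rootform x] and [l] all linear forms are multiples of a single one,
    which can be scaled to take the value 1 at [x]; so [homog_congr] shows that
    [p] is in the ideal of these two forms. Homogeneous components then give the
    degree of the quotient. *)
Lemma root_divide d p x : x != 0 -> ev x l = 0 -> p \is d.-homog ->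
    ev x p = 0 ->
  exists a b, [/\ p = a * rootform x + b * l, a \is d.-1.-homog
                & d = 0%N -> a = 0].
Proof.
move=> x0 xl hp xp.
case: d hp => [|d] hp.
  exists 0, 0; rewrite rpred0; split=> //.
  by rewrite (dhomog0_const x hp) xp mpolyC0; ring.
suff [a [b eqp]] : span2 (rootform x) l p.
  exists (pihomog mdeg d a), (pihomog mdeg d b).
  rewrite pihomogP; split=> //.
  have h1 : rootform x \is 1.-homog.
    by rewrite rpredB // rpredZ // linform_homog.
  rewrite -{1}(pihomog_dE hp) eqp pihomogD !(mulrC _ (rootform x)).
  by rewrite !(mulrC _ l) !(@pihomogMl 1 d) ?linform_homog.
have xE : x = ev x u *: row 0 E + ev x v *: row 1 E.
  by rewrite {1}(vec_expand x) sum3 xl scale0r addr0.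
(* [mu] will be [u] or [v], divided by its value at [x] if that is nonzero. *)
have key mu : span2 (rootform x) l (u - ev x u *: mu) ->
    span2 (rootform x) l (v - ev x v *: mu) -> span2 (rootform x) l p.
  have [_ ID IM] := span2_ideal (rootform x) l => hu hv.
  have := homog_congr (span2_ideal (rootform x) l) _ hp.
  move=> /(_ x mu); rewrite xp scale0r subr0; apply=> j.
  have -> : x 0 j = ev x u * E 0 j + ev x v * E 1 j by rewrite {1}xE !mxE.
  rewrite (coord_expand j) sum3.
  have -> : E 0 j *: u + E 1 j *: v + E ord_max j *: l -
      (ev x u * E 0 j + ev x v * E 1 j) *: mu =
      (E 0 j)%:MP * (u - ev x u *: mu) + (E 1 j)%:MP * (v - ev x v *: mu) +
      (E ord_max j)%:MP * l.
    by rewrite -!mul_mpolyC; ring.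
  apply: (ID); first by apply: ID; apply: IM.
  by exists 0, (E ord_max j)%:MP; ring.
have inv2 (a : k) : a != 0 -> a^-1%:MP * a%:MP = 1 :> R.
  by move=> a0; rewrite -mpolyCM mulVf // mpolyC1.
have [xu|xu] := eqVneq (ev x u) 0; last first.
  have := inv2 _ xu; set c := (_^-1)%:MP => cE.
  apply: (key (c * u)); rewrite /rootform -!mul_mpolyC.
    by exists 0, 0; rewrite mulrA (mulrC _ c) cE; ring.
  by exists (- c), 0; rewrite -{1}[v]mul1r -cE; ring.
have xv : ev x v != 0.
  apply: contraNneq x0 => xv.
  by rewrite xE xu xv !scale0r addr0.
have := inv2 _ xv; set c := (_^-1)%:MP => cE.
apply: (key (c * v)); rewrite /rootform -!mul_mpolyC xu mpolyC0.
  by exists c, 0; rewrite -{1}[u]mul1r -cE; ring.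
by exists 0, 0; rewrite mulrA (mulrC _ c) cE; ring.
Qed.

Lemma rootform_homog x : rootform x \is 1.-homog.
Proof. by rewrite rpredB // rpredZ // linform_homog. Qed.

Lemma ev_rootform x y :
  ev y (rootform x) = ev x v * ev y u - ev x u * ev y v.
Proof. by rewrite mevalB !mevalZ. Qed.

Lemma dird_rootform x : [/\ dird (row 0 E) (rootform x) = (ev x v)%:MP,
  dird (row 1 E) (rootform x) = - (ev x u)%:MP &
  dird (row ord_max E) (rootform x) = 0].
Proof.
rewrite /rootform !dirdB !dirdZ !dird_coord /= mpolyC0 mpolyC1 !scaler0.
by rewrite !alg_mpolyC subr0 sub0r subrr.
Qed.

(** Vectors that represent points of the projective line [l = 0]. That the
    points are distinct means that the vectors are pairwise not proportional,
    hence the condition on [rootform]. *)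
Definition points_on_line (qs : seq 'rV[k]_3) : Prop :=
  [/\ uniq qs, forall x, x \in qs -> x != 0 /\ ev x l = 0
    & {in qs &, forall x y, x != y -> ev y (rootform x) != 0}].

Definition pointsform (qs : seq 'rV[k]_3) : R := \prod_(x <- qs) rootform x.

Lemma pointsform_homog qs : pointsform qs \is (size qs).-homog.
Proof.
elim: qs => [|x qs IH]; rewrite /pointsform ?big_nil ?dhomog1 // big_cons.
exact: (dhomogM (rootform_homog x) IH).
Qed.

(** A form on the line that vanishes at [x] is divisible by [rootform x]; the
    distinct [rootform x] can be split off one after the other, because none
    vanishes at the point of another. *)
Lemma line_divide qs d p : points_on_line qs -> p \is d.-homog ->
    (forall x, x \in qs -> ev x p = 0) ->
  exists a b, [/\ p = a * pointsform qs + b * l, a \is (d - size qs).-homog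
                & (d < size qs)%N -> a = 0].
Proof.
elim: qs => [|x qs IH] [uqs qs0 qs_neq] hp px.
  by exists p, 0; rewrite /pointsform big_nil subn0; split=> //; ring.
have [/= xqs {}uqs] := andP uqs.
have [||a [b [eqp ha _]]] := IH _ hp.
- split=> // [y yqs|y z yqs zqs]; first by apply: qs0; rewrite inE yqs orbT.
  by apply: qs_neq; rewrite inE ?yqs ?zqs orbT.
- by move=> y yqs; apply: px; rewrite inE yqs orbT.
have [x0 xl] : x != 0 /\ ev x l = 0 by apply: qs0; rewrite mem_head.
have ax : ev x a = 0.
  have := px x (mem_head _ _); rewrite eqp mevalD !mevalM xl mulr0 addr0.
  move/eqP; rewrite mulf_eq0 => /orP[/eqP //|]; rewrite /pointsform rmorph_prod.
  rewrite prodf_seq_eq0 => /hasP[y yqs /= /eqP xy0].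
  have /eqP[] : ev x (rootform y) != 0 => //.
  apply: qs_neq; rewrite ?mem_head ?inE ?yqs ?orbT //.
  by apply: contraNneq xqs => <-.
have [a' [b' [eqa ha' a'0]]] := root_divide x0 xl ha ax.
exists a', (b' * pointsform qs + b); split.
- rewrite eqp eqa /pointsform big_cons -/(pointsform qs); ring.
- by rewrite /= subnS.
- by rewrite ltnS -subn_eq0 => /eqP.
Qed.

Section PointsForm.

Variables (qs : seq 'rV[k]_3) (qs_line : points_on_line qs).
Local Notation f := (pointsform qs).
Local Notation f1 := (dird (row 0 E) f).
Local Notation f2 := (dird (row 1 E) f).
Local Notation n := (size qs).

Lemma ev_pointsform x : x \in qs -> ev x f = 0.
Proof.
move=> xqs; rewrite /pointsform (big_rem x xqs) mevalM /= ev_rootform.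
by rewrite (mulrC (ev x v)) subrr mul0r.
Qed.

Lemma dird_pointsform : dird (row ord_max E) f = 0.
Proof.
rewrite /pointsform; elim: qs => [|x s IH].
  by rewrite big_nil -mpolyC1 dirdC.
rewrite big_cons dirdM IH; have [_ _ ->] := dird_rootform x.
by rewrite mul0r mulr0 addr0.
Qed.

(** The zeros of [f] are simple: if [f = rootform x * f'], the constant [c] is
    the value of [f'] at [x], and the gradient of [f] at [x] is [c] times that
    of [rootform x]. *)
Lemma pointsform_gradient x : x \in qs -> exists c : k,
  [/\ c != 0, ev x f1 = c * ev x v & ev x f2 = - (c * ev x u)].
Proof.
have [uqs qs0 qs_neq] := qs_line.
move=> xqs; exists (ev x (\prod_(y <- rem x qs) rootform y)).
rewrite /pointsform (big_rem x xqs) /=.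
set g := \prod_(y <- _) _.
have rx : ev x (rootform x) = 0 by rewrite ev_rootform; ring.
have [d0 d1 _] := dird_rootform x.
split.
- rewrite /g rmorph_prod prodf_seq_neq0; apply/allP=> y /=.
  rewrite mem_rem_uniq // inE => /andP[yx yqs].
  exact: qs_neq.
- by rewrite dirdM d0 mevalD !mevalM rx mevalC; ring.
- by rewrite dirdM d1 mevalD !mevalM rx mevalN mevalC; ring.
Qed.

End PointsForm.

End Forms.

(** * The Hessian of a squarefree binary form *)

Section PolarHessian.
Variable k : fieldType.
Local Notation R := {mpoly k[3]}.
Local Notation ev x := (meval (fun i => x 0 i)).
Implicit Types (p q : R) (x y : 'rV[k]_3) (c : 'cV[k]_3).
Variables (E : 'M[k]_3) (E_unit : E \in unitmx).
Local Notation u := (dual_coord E 0).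
Local Notation v := (dual_coord E 1).
Local Notation l := (dual_coord E ord_max).
Local Notation D1 := (dird (row 0 E)).
Local Notation D2 := (dird (row 1 E)).
Variables (qs : seq 'rV[k]_3) (qs_line : points_on_line E qs).
Local Notation f := (pointsform E qs).
Local Notation n := (size qs).

Lemma ev_dirdMl x y p q :
  ev x p = 0 -> ev x (dird y (p * q)) = ev x (dird y p) * ev x q.
Proof. by move=> px; rewrite dirdM mevalD !mevalM px mul0r addr0. Qed.

(** The Hessian quadratic form of [p], in the two directions along the line,
    applied to the vector [(D2 p, - D1 p)] that is tangent to the level curve of
    [p]. *)
Definition polar_hessian p : R :=
  D2 (D2 p) * D1 p ^+ 2 - 2%:R * D1 (D2 p) * D1 p * D2 p
  + D1 (D1 p) * D2 p ^+ 2.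

Definition hessian p : R := D1 (D1 p) * D2 (D2 p) - D1 (D2 p) ^+ 2.

Lemma euler_line d p : dird (row ord_max E) p = 0 -> p \is d.-homog ->
  u * D1 p + v * D2 p = d%:R * p.
Proof.
move=> p0 hp; have := euler E_unit hp.
by rewrite sum3 p0 mulr0 addr0 mulr_natl => ->.
Qed.

Lemma euler_D1 : u * D1 (D1 f) + v * D1 (D2 f) = n.-1%:R * D1 f.
Proof.
have hf := pointsform_homog E qs.
rewrite (dird_comm (row 0 E) (row 1 E)).
apply: euler_line; last exact: dird_homog.
by rewrite dird_comm dird_pointsform // -mpolyC0 dirdC.
Qed.

Lemma euler_D2 : u * D1 (D2 f) + v * D2 (D2 f) = n.-1%:R * D2 f.
Proof.
have hf := pointsform_homog E qs.
apply: euler_line; last exact: dird_homog.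
by rewrite dird_comm dird_pointsform // -mpolyC0 dirdC.
Qed.

Lemma euler_pointsform : u * D1 f + v * D2 f = n%:R * f.
Proof.
by apply: euler_line; [exact: dird_pointsform|exact: pointsform_homog].
Qed.

(** Euler's relations for [D1 f] and [D2 f] turn one gradient factor in each
    term of [polar_hessian f] into second derivatives. The terms then regroup
    into Euler's relation for [f] itself, with the Hessian as common factor. *)
Lemma polar_hessianE :
  n.-1%:R * polar_hessian f = n%:R * f * hessian f.
Proof.
rewrite /polar_hessian /hessian -euler_pointsform.
transitivity (D2 (D2 f) * D1 f * (n.-1%:R * D1 f)
    - D1 (D2 f) * D1 f * (n.-1%:R * D2 f)
    - D1 (D2 f) * D2 f * (n.-1%:R * D1 f)
    + D1 (D1 f) * D2 f * (n.-1%:R * D2 f)); first by ring.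
by rewrite -euler_D1 -euler_D2; ring.
Qed.

Hypothesis char0 : [pchar k] =i pred0.

(** Euler's relations at [x] say that the Hessian matrix of [f] maps the vector
    [(u, v)] to a known multiple of [(v, - u)]. This gives the product of the
    determinant with [u] and with [v], one of which is nonzero at [x]. *)
Lemma hessian_pointsform x (c : k) : x \in qs ->
    ev x (D1 f) = c * ev x v -> ev x (D2 f) = - (c * ev x u) ->
  ev x (hessian f) = - (n.-1%:R * c) ^+ 2.
Proof.
move=> xqs c1 c2.
have := congr1 (ev x) euler_D1; rewrite mevalD !mevalM c1.
have := congr1 (ev x) euler_D2; rewrite mevalD !mevalM c2.
rewrite !rmorph_nat /hessian mevalB mevalM rmorphXn /=.
set a := ev x u; set b := ev x v; set N : k := n.-1%:R.
set F11 := ev x (D1 (D1 f)); set F12 := ev x (D1 (D2 f)).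
set F22 := ev x (D2 (D2 f)) => e2 e1.
have ab0 : (a != 0) || (b != 0).
  have [_ /(_ x xqs)[x0 xl] _] := qs_line.
  apply: contraNT x0; rewrite negb_or !negbK => /andP[/eqP a0 /eqP b0].
  rewrite (vec_expand E_unit x) sum3 xl -/a -/b a0 b0 !scale0r !addr0 //.
set H := _ - _; suff ha : a * (H + (N * c) ^+ 2) = 0.
  suff hb : b * (H + (N * c) ^+ 2) = 0.
    apply/eqP; rewrite -addr_eq0.
    move/eqP: ha; move/eqP: hb; rewrite !mulf_eq0.
    by case/orP: ab0 => /negPf ->.
  have -> : b * (H + (N * c) ^+ 2) = F11 * (a * F12 + b * F22)
      - F12 * (a * F11 + b * F12) + b * (N * c) ^+ 2 by rewrite /H; ring.
  rewrite e1 e2; transitivity (N * c * (N * (c * b) - (a * F11 + b * F12))).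
    by ring.
  by rewrite e1 subrr mulr0.
have -> : a * (H + (N * c) ^+ 2) = F22 * (a * F11 + b * F12)
    - F12 * (a * F12 + b * F22) + a * (N * c) ^+ 2 by rewrite /H; ring.
rewrite e1 e2; transitivity (N * c * ((a * F12 + b * F22) - N * - (c * a))).
  by ring.
by rewrite e2 subrr mulr0.
Qed.

Lemma polar_hessian_homog m p : p \is (m.+2).-homog ->
  polar_hessian p \is (m + (m.+1 + m.+1)).-homog.
Proof.
move=> hp; have h x : dird x p \is m.+1.-homog by apply: (dird_homog x hp).
have hh x y : dird x (dird y p) \is m.-homog by apply: (dird_homog x (h y)).
rewrite /polar_hessian rpredD ?rpredB //.
- by rewrite dhomogM // expr2 dhomogM.
- by rewrite -!mulrA mulr_natl rpredMn // dhomogM // dhomogM.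
- by rewrite dhomogM // expr2 dhomogM.
Qed.

(** By [polar_hessianE] such an equation would put the Hessian of [f] into the
    ideal of the two derivatives of [f], modulo [l]. Divide [f] out by
    differentiating at a zero [x] of [f]. With the constant [c] of
    [pointsform_gradient], the Hessian is [- ((n - 1) c) ^ 2] there and the
    gradient is [c * (v, - u)], so the form [G = v A - u B] takes the value
    [- n (n - 1) c] at [x]. Hence [u G] and [- v G] agree with [n (n - 1)] times
    [D2 f] and [D1 f] at the [n] zeros of [f]. These are forms of degree
    [n - 1], so they agree on the whole line. By Euler's relation [f] then
    vanishes on the line, which contradicts that its zeros are simple. *)
Lemma polar_hessian_not_in_product A B Q : (3 <= n)%N ->
  polar_hessian f = f * (A * D1 f + B * D2 f) + Q * l -> False.
Proof.
(* Only the components of [A] and [B] of degree [n - 3] contribute to the degree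
   [3 n - 4] of [polar_hessian f]. *)
move=> n3; wlog [hA hB] : A B Q / A \is (n - 3).-homog /\ B \is (n - 3).-homog.
  move=> wl h.
  set d := (n - 3)%N in wl.
  have nE : n = d.+3 by rewrite /d; lia.
  have hf := pointsform_homog E qs.
  have hf' x : dird x f \is (n.-1).-homog by apply: dird_homog.
  apply: (wl (pihomog mdeg d A) (pihomog mdeg d B)
     (pihomog mdeg (n + (n.-1 + d)).-1 Q)); first by rewrite !pihomogP.
  have hw : polar_hessian f \is (n + (n.-1 + d)).-homog.
    have -> : (n + (n.-1 + d) = d.+1 + (d.+2 + d.+2))%N by lia.
    by apply: polar_hessian_homog; rewrite -nE.
  rewrite -{1}(pihomog_dE hw) h pihomogD (pihomogMl _ _ hf) pihomogD.
  rewrite !(mulrC _ (dird _ _)) !(pihomogMl _ _ (hf' _)) (mulrC Q) (mulrC _ l).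
  congr (_ + _).
  have {1}-> : (n + (n.-1 + d) = 1 + (n + (n.-1 + d)).-1)%N by lia.
  by rewrite (pihomogMl _ _ (linform_homog _)).
move=> eqw; have [uqs qs0 _] := qs_line.
have natr0 m : (m%:R == 0 :> k) = (m == 0)%N by apply: (pcharf0P k).1.
set N : k := n.-1%:R; set M : k := n%:R.
have N0 : N != 0 by rewrite natr0; lia.
have M0 : M != 0 by rewrite natr0; lia.
have Dl0 (i : 'I_3) : i != ord_max -> dird (row i E) l = 0.
  by move=> /negPf i2; rewrite dird_coord // i2 mpolyC0.
pose G := v * A - u * B.
have evG x (c : k) : x \in qs -> c != 0 ->
    ev x (D1 f) = c * ev x v -> ev x (D2 f) = - (c * ev x u) ->
    ev x G = - (M * N * c).
  move=> xqs c0 c1 c2.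
  have [x0 xl] := qs0 x xqs.
  have key (i : 'I_3) : i != ord_max ->
      ev x (dird (row i E) f) * (M * ev x (hessian f)) =
      ev x (dird (row i E) f) * (N * ev x (A * D1 f + B * D2 f)).
    move=> i2; transitivity (N * ev x (dird (row i E) (polar_hessian f))).
      have e := congr1 (fun p => ev x (dird (row i E) p)) polar_hessianE.
      rewrite -(mulrA n%:R) !mulr_natl -!scaler_nat !dirdZ !mevalZ in e.
      by rewrite -/N e ev_dirdMl ?ev_pointsform // mulrCA -/M.
    rewrite eqw dirdD mevalD (mulrC Q) !ev_dirdMl ?ev_pointsform //.
    by rewrite Dl0 // meval0 mul0r addr0 mulrCA.
  have {key} : M * ev x (hessian f) = N * ev x (A * D1 f + B * D2 f).
    have [xu|xu] := eqVneq (ev x u) 0.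
      have xv : ev x v != 0.
        apply: contraNneq x0 => xv.
        by rewrite (vec_expand E_unit x) sum3 xl xu xv !scale0r !addr0.
      by apply: (mulfI _ (key 0 _)) => //; rewrite c1 mulf_neq0.
    by apply: (mulfI _ (key 1 _)) => //; rewrite c2 oppr_eq0 mulf_neq0.
  rewrite (hessian_pointsform xqs c1 c2) mevalD !mevalM c1 c2 => eqG.
  apply: (mulfI (mulf_neq0 N0 c0)); rewrite /G mevalB !mevalM.
  transitivity (N * (ev x A * (c * ev x v) + ev x B * - (c * ev x u))).
    by ring.
  by rewrite -eqG; ring.
have evG' x : x \in qs -> ev x u * ev x G = M * N * ev x (D2 f)
                     /\ ev x v * ev x G = - (M * N * ev x (D1 f)).
  move=> xqs; have [c [c0 c1 c2]] := pointsform_gradient E_unit qs_line xqs.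
  by rewrite (evG x c) // c1 c2; split; ring.
have hG : G \is (n.-2).-homog.
  have -> : (n.-2 = 1 + (n - 3))%N by lia.
  by rewrite rpredB // dhomogM // linform_homog.
have inl p : p \is (n.-1).-homog -> (forall x, x \in qs -> ev x p = 0) ->
    exists b, p = b * l.
  move=> hp p0; have [a [b [-> _ a0]]] := line_divide E_unit qs_line hp p0.
  by exists b; rewrite a0 ?mul0r ?add0r //; lia.
have h1 i : dird (row i E) f \is (n.-1).-homog.
  exact: dird_homog (pointsform_homog E qs).
have hc (w : 'cV[k]_3) : linform w * G \is (n.-1).-homog.
  have -> : (n.-1 = 1 + n.-2)%N by lia.
  by rewrite dhomogM // linform_homog.
have [||b1 eb1] := inl (u * G - (M * N) *: D2 f).
- by apply: rpredB; [exact: hc|apply: rpredZ; exact: h1].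
- move=> x /evG'[e _]; by rewrite mevalB mevalM mevalZ e subrr.
have [||b2 eb2] := inl (v * G + (M * N) *: D1 f).
- by apply: rpredD; [exact: hc|apply: rpredZ; exact: h1].
- by move=> x /evG'[_ e]; rewrite mevalD mevalM mevalZ e addNr.
(* Euler's relation combines the two congruences into one for [f]. *)
have fl : (M * N * M) *: f = (u * b2 - v * b1) * l.
  transitivity (u * (b2 * l) - v * (b1 * l)); last by ring.
  rewrite -eb1 -eb2 -scalerA scaler_nat -mulr_natl -euler_pointsform.
  by rewrite -!mul_mpolyC; ring.
have [x xqs] : exists x, x \in qs.
  by case: (qs) n3 => // x s _; exists x; rewrite mem_head.
have [x0 xl] := qs0 x xqs.
have [c [c0 c1 c2]] := pointsform_gradient E_unit qs_line xqs.
have key (i : 'I_3) : i != ord_max -> ev x (dird (row i E) f) = 0.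
  move=> i2; have := congr1 (fun p => ev x (dird (row i E) p)) fl.
  rewrite dirdZ mevalZ (mulrC _ l) ev_dirdMl // Dl0 // meval0 mul0r.
  by move/eqP; rewrite !mulf_eq0 (negPf N0) (negPf M0) => /eqP.
case/eqP: x0; rewrite (vec_expand E_unit x) sum3 xl scale0r addr0.
have /eqP := key 0 isT; rewrite c1 mulf_eq0 (negPf c0) => /eqP ->.
have /eqP := key 1 isT; rewrite c2 oppr_eq0 mulf_eq0 (negPf c0) => /eqP ->.
by rewrite !scale0r addr0.
Qed.

End PolarHessian.

(** * Elements of the Jacobian ideal and of its square *)

Section Obstruction.
Variable k : fieldType.
Local Notation R := {mpoly k[3]}.
Local Notation ev x := (meval (fun i => x 0 i)).
Implicit Types (p q : R) (x y : 'rV[k]_3) (c : 'cV[k]_3).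

Lemma mdeg_split (m : 'X_{1..3}) e : (e <= mdeg m)%N ->
  exists m1 m2, m = (m1 + m2)%MM /\ mdeg m1 = e.
Proof.
elim: e m => [|e IH] m he; first by exists 0%MM, m; rewrite add0m mdeg0.
have [i mi] : exists i, m i != 0%N.
  apply/existsP; apply: contraTT he; rewrite negb_exists => /forallP m0.
  have -> : m = 0%MM; last by rewrite mdeg0.
  by apply/mnmP=> i; rewrite mnm0E; apply/eqP; rewrite -[_ == _]negbK.
have mE : (m - U_(i) + U_(i))%MM = m by rewrite submK // lep1mP.
have [|m1 [m2 [eqm hm1]]] := IH (m - U_(i))%MM.
  by move: he; rewrite -{1}mE mdegD mdeg1 addn1 ltnS.
exists (U_(i) + m1)%MM, m2; rewrite mdegD mdeg1 hm1 add1n; split=> //.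
by rewrite -{1}mE eqm addmC addmA.
Qed.

(** A monomial of degree at least 4 is a multiple of the product of two
    quadratic monomials. This is where the bound on the number of points on the
    line enters: it is applied to second derivatives of [f], with [z] a product
    of two first derivatives. *)
Lemma ideal_quadric_mul (K : R -> Prop) (z : R) d : is_ideal K ->
    (forall q q', q \is 2.-homog -> q' \is 2.-homog -> K (q * q' * z)) ->
    (4 <= d)%N ->
  forall p, p \is d.-homog -> K (p * z).
Proof.
move=> [K0 KD KM] Kqq d4; apply: dhomog_ind => [|p q Kp Kq|a m hm].
- by rewrite mul0r.
- by rewrite mulrDl; apply: KD.
have [|m1 [m2 [-> hm1]]] := @mdeg_split m 4%N; first by rewrite hm.
have [|m3 [m4 [m1E hm3]]] := @mdeg_split m1 2%N; first by rewrite hm1.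
have hm4 : mdeg m4 = 2%N by move: hm1; rewrite m1E mdegD hm3 => -[].
rewrite m1E !mpolyXD -mul_mpolyC.
have -> : a%:MP * ('X_[m3] * 'X_[m4] * 'X_[m2]) * z =
   (a%:MP * 'X_[m2]) * ('X_[m3] * 'X_[m4] * z) :> R by ring.
by apply/KM/Kqq; rewrite dhomogX /= ?hm3 ?hm4.
Qed.

(** A 2 x 2 minor of the Jacobian matrix of [(p, q)], with respect to arbitrary
    directions instead of coordinate directions. *)
Definition bracket x y p q : R := dird x p * dird y q - dird y p * dird x q.

Variables (E : 'M[k]_3) (E_unit : E \in unitmx).
Local Notation u := (dual_coord E 0).
Local Notation v := (dual_coord E 1).
Local Notation l := (dual_coord E ord_max).
Local Notation D1 := (dird (row 0 E)).
Local Notation D2 := (dird (row 1 E)).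

Lemma dird_expand x p :
  dird x p = \sum_i ev x (dual_coord E i) *: dird (row i E) p.
Proof.
under eq_bigr => i _ do rewrite scaler_sumr.
rewrite exchange_big; apply: eq_bigr => j _ /=.
rewrite {1}(vec_expand E_unit x) summxE scaler_suml.
by apply: eq_bigr => i _; rewrite scalerA !mxE.
Qed.

Variables (qs : seq 'rV[k]_3) (qs_line : points_on_line E qs).
Local Notation f := (pointsform E qs).
Local Notation n := (size qs).

Variables (A : 'M[k]_3) (A_unit : A \in unitmx).
Local Notation a i := (dual_coord A i).
Hypothesis A_off : forall i, ev (row i A) l != 0.

(* [I] is the Jacobian ideal of [J]; together with [J_min] and [I_min] below,
   the hypotheses describe the two ideals by generators that do not depend on a
   choice of coordinates or of equations. *)
Variables I J : R -> Prop.
Hypotheses (idI : is_ideal I) (JI : forall p, J p -> I p).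
Hypothesis J_in : forall d p, p \is d.-homog ->
  (forall x, x \in qs -> ev x p = 0) -> (forall i, ev (row i A) p = 0) -> J p.
Hypothesis I_bracket :
  forall x y p q, J p -> J q -> I (bracket x y p q).

Lemma ev_line x : x \in qs -> ev x l = 0.
Proof. by case: qs_line => _ h _ /h[]. Qed.

(** Here [a i] is the side of the triangle opposite to the vertex [i]. Modulo
    [J], this is the bracket of [l * (a i * a j)] and [l * (a i * a h)] in the
    directions of the vertices [j] and [h]. *)
Lemma line2_vertex2_in i : I (l ^+ 2 * a i ^+ 2).
Proof.
have [j [h [ij ih jh]]] : exists j h : 'I_3, [/\ i != j, i != h & j != h].
  by exists (i + 1), (i + 1 + 1); case: i => [[|[|[|]]]].
have Jl j' : i != j' -> J (l * (a i * a j')).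
  move=> ij'; apply: (@J_in (1 + (1 + 1))%N).
  - by rewrite !dhomogM // linform_homog.
  - by move=> x xqs; rewrite !mevalM ev_line // mul0r.
  - move=> m; rewrite !mevalM !ev_coord //.
    have [->|_] := eqVneq m i; last by rewrite mul0r mulr0.
    by rewrite (negPf ij') !mulr0.
have := I_bracket (row j A) (row h A) (Jl j ij) (Jl h ih).
rewrite /bracket !dirdM !dird_coord // !eqxx.
rewrite (eq_sym j i) (eq_sym h i) (eq_sym h j).
rewrite (negPf ij) (negPf ih) (negPf jh) mpolyC0 mpolyC1 => Ib.
have [_ ID IM] := idI.
have -> : l ^+ 2 * a i ^+ 2 =
  ((dird (row j A) l * (a i * a j) + l * (0 * a j + a i * 1)) *
   (dird (row h A) l * (a i * a h) + l * (0 * a h + a i * 1)) -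
   (dird (row h A) l * (a i * a j) + l * (0 * a j + a i * 0)) *
   (dird (row j A) l * (a i * a h) + l * (0 * a h + a i * 0)))
  - dird (row h A) l * a i * (l * (a i * a h))
  - dird (row j A) l * a i * (l * (a i * a j)) by ring.
by do 2![apply: ideal_sub => //; last by apply/IM/JI/Jl].
Qed.

(** Subtracting [l ^+ e * vertex_part e m p] from a form [p] of degree [e + m]
    makes it vanish at the three vertices without changing it on the line. *)
Definition vertex_part e m p : R :=
  \sum_i (ev (row i A) p / ev (row i A) l ^+ e) *: a i ^+ m.

Lemma linform_exp_homog (w : 'cV[k]_3) m : linform w ^+ m \is m.-homog.
Proof. by have := dhomogMn m (linform_homog w); rewrite mul1n. Qed.

Lemma vertex_part_homog e m p : vertex_part e m p \is m.-homog.
Proof. by apply: rpred_sum => i _; apply/rpredZ/linform_exp_homog. Qed.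

Lemma vertex_part_sub_homog e m p : p \is (e + m).-homog ->
  p - l ^+ e * vertex_part e m p \is (e + m).-homog.
Proof.
move=> hp; rewrite rpredB // dhomogM ?vertex_part_homog //.
exact: linform_exp_homog.
Qed.

Lemma ev_vertex_part e m p j : (0 < m)%N ->
  ev (row j A) (p - l ^+ e * vertex_part e m p) = 0.
Proof.
move=> m0; rewrite mevalB mevalM rmorphXn /=; have := A_off j.
set L := ev _ l => L0.
rewrite /vertex_part raddf_sum /=.
rewrite (bigD1 j) //= big1 => [|i ij];
  rewrite mevalZ rmorphXn /= ev_coord //.
  by rewrite -/L eqxx expr1n mulr1 addr0 mulrC divfK ?subrr // expf_neq0.
by rewrite eq_sym (negPf ij) expr0n eqn0Ngt m0 mulr0.
Qed.

(** After subtraction of its vertex part, [p] vanishes at the vertices and [l *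
    p] is in [J]; the vertex part is a combination of powers of the [a i],
    covered by [line2_vertex2_in]. *)
Lemma line_multiple_in d p : (3 <= d)%N -> p \is d.-homog -> I (l * p).
Proof.
move=> d3 hp; have [_ ID IM] := idI.
have dE : (d = 1 + d.-1)%N by lia.
rewrite -(subrK (l ^+ 1 * vertex_part 1 d.-1 p) p) mulrDr; apply: ID.
  apply: JI; apply: (@J_in (1 + d)%N).
  - by rewrite dhomogM ?linform_homog // {2}dE vertex_part_sub_homog -?dE.
  - by move=> x xqs; rewrite mevalM ev_line // mul0r.
  - by move=> i; rewrite mevalM ev_vertex_part ?mulr0 //; lia.
rewrite /vertex_part mulr_sumr mulr_sumr; apply: ideal_sum => // i.
rewrite -!scalerAr -mul_mpolyC; apply: (IM).
have -> : l * (l ^+ 1 * a i ^+ d.-1) = a i ^+ (d - 3) * (l ^+ 2 * a i ^+ 2).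
  by rewrite (_ : d.-1 = (d - 3) + 2)%N ?exprD; [ring | lia].
exact/IM/line2_vertex2_in.
Qed.

(** Up to multiples of [l], which are in [I] by [line_multiple_in], this is the
    bracket of [l * q] and [p], corrected at the vertices so as to lie in [J].
    One direction is transversal to the line and the other tangent to it, so
    that the derivatives of [l] are 1 and 0. *)
Lemma quadric_dird_in d p q (i : 'I_3) : (3 <= d)%N -> p \is d.-homog ->
    (forall x, x \in qs -> ev x p = 0) -> q \is 2.-homog -> i != ord_max ->
  I (q * dird (row i E) p).
Proof.
move=> d3 hp p0 hq i2; have [_ ID IM] := idI.
set D := dird (row i E); set D3 := dird (row ord_max E).
have dE : (d = 1 + d.-1)%N by lia.
set cp := vertex_part 1 d.-1 p; set cq := vertex_part 1 1 q.
set p' := p - l ^+ 1 * cp; set q' := q - l ^+ 1 * cq.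
have hcp : cp \is d.-1.-homog by apply: vertex_part_homog.
have hcq : cq \is 1.-homog by apply: vertex_part_homog.
have hp' : p' \is d.-homog by rewrite dE vertex_part_sub_homog -?dE.
have hq' : q' \is 2.-homog by apply: (@vertex_part_sub_homog 1 1).
have Jp' : J p'.
  apply: (J_in hp') => [x xqs|j]; last by apply: ev_vertex_part; lia.
  by rewrite mevalB mevalM rmorphXn /= ev_line // p0 // expr1 mul0r subrr.
have Jlq' : J (l * q').
  apply: (@J_in (1 + 2)%N) => [|x xqs|j].
  - by rewrite dhomogM // linform_homog.
  - by rewrite mevalM ev_line // mul0r.
  - by rewrite mevalM ev_vertex_part ?mulr0.
have D_l : D l = 0 by rewrite /D dird_coord // (negPf i2) mpolyC0.
have D3_l : D3 l = 1 by rewrite /D3 dird_coord // eqxx mpolyC1.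
have hM d1 d2 (r r' : R) : r \is d1.-homog -> r' \is d2.-homog ->
    (d1 + d2)%N = d -> r * r' \is d.-homog by move=> h h' <-; apply: dhomogM.
have e1 : q * D p = bracket (row ord_max E) (row i E) (l * q') p' +
    l * (D q' * D3 p' - D3 q' * D p' + (q * D cp + cq * D p')).
  rewrite /bracket /p' /q' expr1 /D /D3 !(dirdM, dirdB) -/D -/D3 D_l D3_l.
  ring.
rewrite e1; apply: (ID); first exact: I_bracket.
apply: (line_multiple_in d3); apply: rpredD; [apply: rpredB|apply: rpredD].
- by apply: hM (dird_homog _ hq') (dird_homog _ hp') _; lia.
- by apply: hM (dird_homog _ hq') (dird_homog _ hp') _; lia.
- by apply: hM hq (dird_homog _ hcp) _; lia.
- by apply: hM hcq (dird_homog _ hp') _; lia.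
Qed.

Local Notation H := (polar_hessian E f).

Lemma polar_hessian_in_square : (6 <= n)%N -> ideal_exp I 2 H.
Proof.
move=> n6; have hf := pointsform_homog E qs.
have n3 : (3 <= n)%N by lia.
have f0 x : x \in qs -> ev x f = 0 by apply: ev_pointsform.
have key (i j i' j' : 'I_3) : i != ord_max -> j != ord_max ->
    ideal_exp I 2 (dird (row i' E) (dird (row j' E) f) *
                   (dird (row i E) f * dird (row j E) f)).
  move=> i2 j2; apply: (@ideal_quadric_mul _ _ n.-1.-1) => [|q q' hq hq'||].
  - exact: ideal_gen_ideal.
  - rewrite mulrACA; apply: ideal_exp2_mem; exact: (quadric_dird_in n3 hf).
  - by lia.
  - by do 2![apply: dird_homog].
have [_ KD KM] := ideal_gen_ideal (fun h => exists a b : R,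
  [/\ I a, ideal_exp I 1 b & h = a * b]).
rewrite /polar_hessian; apply: (KD); last by rewrite expr2; apply: key.
apply: ideal_sub; [exact: ideal_gen_ideal|by rewrite expr2; apply: key|].
by rewrite -!mulrA; apply: KM; apply: key.
Qed.

Lemma vertex_part_in_square m p : (6 <= m)%N ->
  ideal_exp I 2 (l ^+ 2 * vertex_part 2 m p).
Proof.
move=> m6; rewrite /vertex_part mulr_sumr; apply: ideal_sum => [|i].
  exact: ideal_gen_ideal.
have [_ _ KM] := ideal_gen_ideal (fun h => exists a b : R,
  [/\ I a, ideal_exp I 1 b & h = a * b]).
rewrite -scalerAr -mul_mpolyC; apply: (KM).
have -> : l ^+ 2 * a i ^+ m =
    a i ^+ (m - 6) * ((l * a i ^+ 3) * (l * a i ^+ 3)).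
  by rewrite {1}(_ : m = (m - 6) + 6)%N ?exprD; [ring | lia].
by apply: KM; apply: ideal_exp2_mem; apply: (@line_multiple_in 3) => //;
  apply: linform_exp_homog.
Qed.

Hypothesis char0 : [pchar k] =i pred0.
Hypothesis J_min : forall K, is_ideal K ->
  (forall d p, p \is d.-homog -> (forall x, x \in qs -> ev x p = 0) -> K p) ->
  forall p, J p -> K p.
Hypothesis I_min : forall K, is_ideal K -> (forall p, J p -> K p) ->
  (forall x y p q, J p -> J q -> K (bracket x y p q)) -> forall p, I p -> K p.

Lemma J_on_line p : J p -> span2 f l p.
Proof.
move: p; apply: J_min => [|d p hp p0]; first exact: span2_ideal.
by have [b [c [-> _ _]]] := line_divide E_unit qs_line hp p0; exists b, c.
Qed.

(** If [p = b f + c l], then all derivatives of [p] are congruent to [c] times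
    those of [l], modulo [f] and its derivatives; the bracket of two constant
    multiples of the gradient of [l] is zero. Euler's relation puts [f] itself
    into the ideal. *)
Lemma I_on_line p : (1 <= n)%N -> I p -> span3 (D1 f) (D2 f) l p.
Proof.
move=> n1; have [K0 KD KM] := span3_ideal (D1 f) (D2 f) l.
have K1 : span3 (D1 f) (D2 f) l (D1 f) by exists 1, 0, 0; ring.
have K2 : span3 (D1 f) (D2 f) l (D2 f) by exists 0, 1, 0; ring.
have Kl : span3 (D1 f) (D2 f) l l by exists 0, 0, 1; ring.
have Kd x : span3 (D1 f) (D2 f) l (dird x f).
  rewrite (dird_expand x) sum3 dird_pointsform // scaler0 addr0 -!mul_mpolyC.
  by apply: (KD); apply: (KM).
have Kf : span3 (D1 f) (D2 f) l f.
  have n0 : n%:R != 0 :> k by rewrite ((pcharf0P k).1 char0); lia.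
  have fE : f = (n%:R^-1)%:MP * (u * D1 f + v * D2 f).
    rewrite (euler_pointsform E_unit) mul_mpolyC mulr_natl -scaler_nat scalerA.
    by rewrite mulVf // scale1r.
  rewrite [X in span3 _ _ _ X]fE.
  by apply: (KM); apply: (KD); apply: (KM).
move: p; apply: I_min => [|p /J_on_line[b [c ->]]|x y p q].
- exact: span3_ideal.
- by apply: (KD); apply: (KM).
move=> /J_on_line[b [c ->]] /J_on_line[b' [c' ->]].
(* [Bx] is the part of the derivative of [b f + c l] that is in the ideal, and
   likewise for the other three. *)
rewrite /bracket !dirdD !dirdM.
pose Bx := dird x b * f + b * dird x f + dird x c * l.
pose By := dird y b * f + b * dird y f + dird y c * l.
pose Bx' := dird x b' * f + b' * dird x f + dird x c' * l.
pose By' := dird y b' * f + b' * dird y f + dird y c' * l.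
have KB z (e e' : R) :
    span3 (D1 f) (D2 f) l (dird z e * f + e * dird z f + dird z e' * l).
  by apply: (KD); first apply: (KD); apply: (KM).
set g := (X in span3 _ _ _ X).
have -> : g = By' * Bx + c * dird x l * By' + c' * dird y l * Bx
    - (Bx' * By + c * dird y l * Bx' + c' * dird x l * By).
  by rewrite /g /Bx /By /Bx' /By'; ring.
apply: ideal_sub; first exact: span3_ideal.
  by apply: (KD); first apply: (KD); apply: KM; apply: KB.
by apply: (KD); first apply: (KD); apply: KM; apply: KB.
Qed.

(** The intersection of [J] with the square of [I] contains an element that is
    congruent to [polar_hessian f] modulo the square of [l] and is not in [J I].
    *)
Theorem not_VV_torsion_free : (6 <= n)%N -> ~ VV_torsion_free J I.
Proof.
move=> n6 /(_ 2 isT) VV.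
have nE : n = (n - 2).+2 by lia.
set d := (3 * n - 6)%N.
have hH : H \is (2 + d).-homog.
  have -> : (2 + d = (n - 2) + ((n - 2).+1 + (n - 2).+1))%N by rewrite /d; lia.
  by apply: polar_hessian_homog; rewrite -nE; apply: pointsform_homog.
have H0 x : x \in qs -> ev x H = 0.
  move=> xqs; have := congr1 (ev x) (polar_hessianE E_unit qs).
  rewrite !mevalM !rmorph_nat ev_pointsform // mulr0 mul0r => /eqP.
  by rewrite mulf_eq0 ((pcharf0P k).1 char0) => /orP[|/eqP//]; lia.
pose w := H - l ^+ 2 * vertex_part 2 d H.
have Jw : J w.
  apply: (@J_in (2 + d)) => [|x xqs|j].
  - exact: vertex_part_sub_homog.
  - by rewrite mevalB mevalM rmorphXn /= ev_line // H0 // expr2 !mul0r subrr.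
  - by apply: ev_vertex_part; rewrite /d; lia.
have I2w : ideal_exp I 2 w.
  apply: ideal_sub; first exact: ideal_gen_ideal.
    exact: polar_hessian_in_square.
  by apply: vertex_part_in_square; rewrite /d; lia.
have idK := span3_ideal (f * D1 f) (f * D2 f) l.
have [B [C [Q wE]]] : span3 (f * D1 f) (f * D2 f) l w.
  move: ((VV w).1 (conj Jw I2w)) => /=.
  apply: (ideal_mul_exp1_sub idI idK) => p q /J_on_line[b [c ->]] /I_on_line.
  case=> [|b' [c' [e ->]]]; first by lia.
  exists (b * b'), (b * c'), (b * f * e + c * (b' * D1 f + c' * D2 f + e * l)).
  by ring.
apply: (polar_hessian_not_in_product E_unit qs_line char0 (A := B) (B := C)
  (Q := Q + l * vertex_part 2 d H)); first by lia.
by rewrite -[LHS](subrK (l ^+ 2 * vertex_part 2 d H)) -/w wE; ring.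
Qed.

End Obstruction.

(** * The Jacobian ideal *)

Lemma det_mx2 (A : comNzRingType) (M : 'M[A]_2) :
  \det M = M 0 0 * M 1 1 - M 0 1 * M 1 0.
Proof.
rewrite (expand_det_row _ 0) !big_ord_recl big_ord0 addr0 /cofactor !det_mx11.
rewrite !mxE /= !addn0 !add0n expr0 expr1 mul1r mulN1r mulrN.
by congr (M _ _ * M _ _ - M _ _ * M _ _); apply: val_inj.
Qed.

Section Jacobian.

Variable k : fieldType.
Local Notation R := {mpoly k[3]}.
Implicit Types (p q : R) (x y : 'rV[k]_3) (J : R -> Prop).

Lemma bracketMl x y a p q :
  bracket x y (a * p) q = a * bracket x y p q + p * bracket x y a q.
Proof. by rewrite /bracket !dirdM; ring. Qed.

Lemma bracketC x y p q : bracket x y p q = - bracket x y q p.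
Proof. by rewrite /bracket; ring. Qed.

Lemma bracket_suml x y (T : Type) (r : seq T) (F : T -> R) q :
  bracket x y (\sum_(i <- r) F i) q = \sum_(i <- r) bracket x y (F i) q.
Proof.
elim/big_rec2: _ => [|i p p' _ <-].
  by rewrite /bracket -mpolyC0 !dirdC mpolyC0; ring.
by rewrite /bracket !dirdD; ring.
Qed.

Variables (J : R -> Prop) (m : nat) (g : m.-tuple R).
Hypothesis gJ : homogeneous_generators J g.
Local Notation I := (jacobian_ideal J g).

Lemma jacobian_ideal_ideal : is_ideal I.
Proof. exact: ideal_gen_ideal. Qed.

Lemma jacobian_ideal_sub p : J p -> I p.
Proof. by move=> Jp; apply: ideal_gen_mem; left. Qed.

Lemma bracket_gen x y i j : I (bracket x y (tnth g i) (tnth g j)).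
Proof.
have -> : bracket x y (tnth g i) (tnth g j) =
    \sum_c \sum_c' (x 0 c * y 0 c')%:MP *
      ((tnth g i)^`M(c) * (tnth g j)^`M(c') -
       (tnth g i)^`M(c') * (tnth g j)^`M(c)).
  rewrite /bracket /dird !mulr_suml.
  under eq_bigr => c _ do rewrite mulr_sumr.
  under [X in _ - X]eq_bigr => c _ do rewrite mulr_sumr.
  rewrite [X in _ - X]exchange_big -sumrB; apply: eq_bigr => c _ /=.
  rewrite -sumrB; apply: eq_bigr => c' _; rewrite mpolyCM -!mul_mpolyC.
  ring.
apply: ideal_sum => [|c]; first exact: jacobian_ideal_ideal.
apply: ideal_sum => [|c']; first exact: jacobian_ideal_ideal.
have [_ _ IM] := jacobian_ideal_ideal; apply: IM.
apply: ideal_gen_mem; right.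
exists (fun a => if a == 0 then i else j), (fun b => if b == 0 then c else c').
by rewrite det_mx2 !mxE.
Qed.

(** The bracket is bilinear and a derivation in each argument, so modulo [J] it
    is determined by its values on generators; this is why the Jacobian ideal is
    independent of the generators. *)
Lemma jacobian_bracket x y p q : J p -> J q -> I (bracket x y p q).
Proof.
have idI := jacobian_ideal_ideal; have [_ ID IM] := idI.
have [_ Jgen] := gJ.
have Jg i : J (tnth g i).
  by apply: (Jgen _).2; apply: ideal_gen_mem; apply: mem_tnth.
have step q0 : J q0 -> (forall i, I (bracket x y (tnth g i) q0)) ->
    forall p0, J p0 -> I (bracket x y p0 q0).
  move=> Jq0 h p0 /Jgen [N [a [b [bg ->]]]].
  rewrite bracket_suml; apply: ideal_sum => // i.
  have /tnthP[j ->] := bg i.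
  rewrite bracketMl; apply: (ID); first by apply: (IM).
  by apply: ideal_mulr => //; apply: jacobian_ideal_sub.
move=> Jp Jq; apply: (step) => // i; rewrite bracketC; apply: ideal_opp => //.
by apply: (step) => // j; apply: bracket_gen.
Qed.

Lemma jacobian_ideal_min (K : R -> Prop) : is_ideal K ->
    (forall p, J p -> K p) ->
    (forall x y p q, J p -> J q -> K (bracket x y p q)) ->
  forall p, I p -> K p.
Proof.
move=> idK JK brK; apply: ideal_gen_sub => // p [/JK//|[r [c ->]]].
rewrite det_mx2 !mxE.
have d_delta (h : 'I_3) q : dird (delta_mx 0 h) q = q^`M(h).
  rewrite /dird (bigD1 h) //= big1 => [|j jh].
    by rewrite mxE !eqxx scale1r addr0.
  by rewrite mxE (negPf jh) andbF scale0r.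
have Jg i : J (tnth g i).
  by apply: (gJ.2 _).2; apply: ideal_gen_mem; apply: mem_tnth.
have := brK (delta_mx 0 (c 0)) (delta_mx 0 (c 1)) _ _ (Jg (r 0)) (Jg (r 1)).
by rewrite /bracket !d_delta.
Qed.

End Jacobian.

(** * Points of the plane *)

Section Points.

Variable k : fieldType.
Implicit Types (P Q T : proj_point k) (L : proj_line k) (x y : 'rV[k]_3).
Local Notation ev x := (meval (fun i => x 0 i)).

Definition repr P : 'rV[k]_3 := vpick (val P).

Lemma repr_neq0 P : repr P != 0.
Proof. by rewrite /repr vpick0 -dimv_eq0 (eqP (valP P)). Qed.

Lemma reprE P : val P = <[repr P]>%VS.
Proof.
apply/eqP; rewrite eq_sym eqEdim -memvE memv_pick /= dim_vline repr_neq0.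
by rewrite (eqP (valP P)).
Qed.

Lemma repr_inj : injective repr.
Proof. by move=> P Q PQ; apply: val_inj; rewrite !reprE PQ. Qed.

Lemma point_eq P Q : repr Q \in val P -> P = Q.
Proof.
move=> QP; apply: val_inj; apply/eqP; rewrite eq_sym eqEdim (reprE Q) -memvE QP.
by rewrite -reprE (eqP (valP P)) (eqP (valP Q)).
Qed.

Lemma vanishes_repr d p P : p \is d.-homog ->
  (vanishes_at p P <-> ev (repr P) p = 0).
Proof.
move=> hp; split=> [|p0 x]; first by apply; apply: memv_pick.
by rewrite reprE => /vlineP[c ->]; rewrite (ev_scale _ _ hp) p0 mulr0.
Qed.

Definition frame P Q T : 'M[k]_3 :=
  \matrix_(i, j) (tnth [tuple repr P; repr Q; repr T] i) 0 j.

Lemma row_frame P Q T : [/\ row 0 (frame P Q T) = repr P,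
  row 1 (frame P Q T) = repr Q & row ord_max (frame P Q T) = repr T].
Proof. by split; apply/rowP=> j; rewrite !mxE. Qed.

Lemma dim_join P Q : P != Q -> \dim (val P + val Q) = 2%N.
Proof.
move=> PQ; rewrite dimv_disjoint_sum.
  by rewrite (eqP (valP P)) (eqP (valP Q)).
apply/eqP; rewrite -subv0; apply/subvP => x; rewrite memv_cap => /andP[xP xQ].
rewrite memv0; apply: contraNT PQ => x0; apply/eqP/point_eq.
move: xQ; rewrite reprE => /vlineP[c xc].
have c0 : c != 0 by apply: contraNneq x0 => c0; rewrite xc c0 scale0r.
by rewrite -[repr Q](scalerK c0) -xc memvZ.
Qed.

Lemma frame_unit P Q T : P != Q -> ~~ (val T <= val P + val Q)%VS ->
  frame P Q T \in unitmx.
Proof.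
move=> PQ PQT; rewrite -row_free_unit; apply: inj_row_free => y.
rewrite mulmx_sum_row sum3; have [-> -> ->] := row_frame P Q T => yE.
have solve (V : {vspace 'rV[k]_3}) (c : k) x z :
    c != 0 -> z \in V -> c *: x + z = 0 -> x \in V.
  move=> c0 zV /eqP; rewrite addr_eq0 => /eqP cx.
  by rewrite -[x](scalerK c0) cx memvZ // memvN.
have Pmem (S : proj_point k) : repr S \in val S by apply: memv_pick.
have y2 : y 0 ord_max = 0.
  apply/eqP; apply: contraNT PQT => y20; rewrite reprE -memvE.
  apply: (solve _ _ _ _ y20 _ (etrans (addrC _ _) yE)).
  by rewrite memv_add // memvZ.
rewrite y2 scale0r addr0 in yE.
have y1 : y 0 1 = 0.
  apply/eqP; apply: contraNT PQ => y10; apply/eqP/point_eq.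
  apply: (solve _ _ _ _ y10 _ (etrans (addrC _ _) yE)).
  by rewrite memvZ.
have y0 : y 0 0 = 0.
  move/eqP: yE; rewrite y1 scale0r addr0 scaler_eq0 (negPf (repr_neq0 P)) orbF.
  by move/eqP.
apply/rowP => i; rewrite mxE.
have [->|[->|->]] : i = 0 \/ i = 1 \/ i = ord_max :> 'I_3;
  rewrite ?y0 ?y1 ?y2 //.
by case: i => [[|[|[|//]]] hi]; [left|right; left|right; right]; apply: val_inj.
Qed.

(** In the frame [(P, Q, T)] the third coordinate is an equation of the line
    through [P] and [Q]. *)
Lemma frame_line P Q T x : P != Q -> ~~ (val T <= val P + val Q)%VS ->
  (x \in (val P + val Q)%VS) =
  (ev x (dual_coord (frame P Q T) ord_max) == 0).
Proof.
move=> PQ PQT; have U := frame_unit PQ PQT.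
have [r0 r1 r2] := row_frame P Q T.
have Pmem (S : proj_point k) : repr S \in val S by apply: memv_pick.
apply/idP/eqP => [/memv_addP[y yP [z zQ ->]]|x0]; last first.
  by rewrite (vec_expand U x) sum3 x0 scale0r addr0 r0 r1 memv_add // memvZ.
move: yP zQ; rewrite !reprE => /vlineP[c ->] /vlineP[c' ->].
rewrite -r0 -r1 ev_linform mulmxDl -!scalemxAl !(row_coord U) !mxE.
by rewrite !mulr0n !mulr0 addr0.
Qed.

End Points.

Section Configuration.

Variable k : closedFieldType.
Implicit Types (X : {fset proj_point k}) (L : proj_line k).
Local Notation ev x := (meval (fun i => x 0 i)).

Lemma card_points_on_off X L :
  (#|` points_on X L|%fset + #|` points_off X L|%fset = #|` X|%fset)%N.
Proof.
have eon : (X `&` points_on X L = points_on X L)%fset.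
  by apply/fsetP=> P; rewrite !inE andbA andbb.
have eoff : (X `\` points_on X L = points_off X L)%fset.
  by apply/fsetP=> P; rewrite !inE; case: (P \in X); rewrite ?andbF ?andbT.
by rewrite -(cardfsID (points_on X L) X) eon eoff.
Qed.

Lemma line_join P Q L : P != Q -> on_line P L -> on_line Q L ->
  val L = (val P + val Q)%VS.
Proof.
move=> PQ PL QL; apply/eqP; rewrite eq_sym eqEdim subv_add.
by rewrite (dim_join PQ) (eqP (valP L)) leqnn andbT; apply/andP.
Qed.

Lemma points_on_line_frame P Q T (ps : seq (proj_point k)) :
    P != Q -> ~~ (val T <= val P + val Q)%VS -> uniq ps ->
    (forall S, S \in ps -> (val S <= val P + val Q)%VS) ->
  points_on_line (frame P Q T) (map (@repr k) ps).
Proof.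
move=> PQ PQT ups psL; have U := frame_unit PQ PQT.
have l0 S : S \in ps -> ev (repr S) (dual_coord (frame P Q T) ord_max) = 0.
  by move/psL; rewrite reprE -memvE (frame_line _ PQ PQT) => /eqP.
split; first by rewrite map_inj_uniq //; apply: repr_inj.
- by move=> _ /mapP[S Sps ->]; rewrite repr_neq0 l0.
move=> _ _ /mapP[S Sps ->] /mapP[S' Sps' ->]; apply: contraNneq.
have [r0 r1 _] := row_frame P Q T.
have yE := vec_expand U (repr S'); have xE := vec_expand U (repr S).
rewrite sum3 l0 // scale0r addr0 r0 r1 in xE.
rewrite sum3 l0 // scale0r addr0 r0 r1 in yE.
rewrite ev_rootform => /eqP; rewrite subr_eq0 => /eqP.
set x0 := ev _ _ in xE *; set x1 := ev _ _ in xE *.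
set y0 := ev _ _ in yE *; set y1 := ev _ _ in yE *.
have fin (c c' : k) : c != 0 -> c *: repr S' = c' *: repr S ->
    repr S == repr S'.
  move=> c0 e; rewrite (@point_eq _ S S') // -[repr S'](scalerK c0) e.
  by rewrite !memvZ // memv_pick.
have [z|x00] := eqVneq x0 0; last first.
  move=> e; apply: (fin _ y0 x00); rewrite xE yE !scalerDr !scalerA -e.
  by rewrite (mulrC x0) (mulrC x1).
have x10 : x1 != 0.
  apply: contraNneq (repr_neq0 S) => z'.
  by rewrite xE z z' !scale0r addr0.
rewrite z mul0r => /eqP; rewrite mulf_eq0 (negPf x10) => /eqP y00.
apply: (fin _ y1 x10); rewrite xE yE z y00 !scale0r !add0r !scalerA.
by rewrite mulrC.
Qed.

End Configuration.

Theorem theorem2p4 (k : closedFieldType) (chark0 : [pchar k] =i pred0)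
  (s : nat) (s_ge9 : (9 <= s)%N)
  (X : {fset proj_point k}) (L : proj_line k)
  (XL : collinear_configuration s 3 X L)
  (glp : general_linear_position (points_off X L))
  (m : nat) (g : m.-tuple {mpoly k[3]})
  (gJ : homogeneous_generators (defining_ideal X) g) :
  ~ VV_torsion_free (defining_ideal X) (jacobian_ideal (defining_ideal X) g).
Proof.
have [_ _ cX con] := XL.
have coff : #|` points_off X L|%fset = 3%N.
  by have := card_points_on_off X L; rewrite cX con; lia.
have [_ gl] := glp.
have uoff : uniq (points_off X L) by apply: fset_uniq.
have uon : uniq (points_on X L) by apply: fset_uniq.
case offE : (enum_fset (points_off X L)) coff uoff =>
  [|A0 [|A1 [|A2 []]]] //= _.
rewrite !inE negb_or andbT => /andP[/andP[A01 A02] A12].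
have Aoff S : S \in [:: A0; A1; A2] -> S \in X /\ ~~ on_line S L.
  rewrite -offE => SA; have : S \in points_off X L by [].
  by rewrite !inE => /andP.
have A012 : ~~ (val A2 <= val A0 + val A1)%VS.
  apply/negP => A2L.
  pose L' : proj_line k :=
    exist _ (val A0 + val A1)%VS (introT eqP (dim_join A01)).
  have off S : S \in [:: A0; A1; A2] -> S \in points_off X L by rewrite -offE.
  apply: (gl A0 A1 A2 _ _ _ A01 A02 A12 L'); rewrite ?off ?inE ?eqxx ?orbT //.
  by rewrite /on_line /= addvSl addvSr A2L.
set ps := enum_fset (points_on X L) in uon.
have psE S : (S \in ps) = (S \in X) && on_line S L.
  by rewrite -[LHS]/(S \in points_on X L) !inE.
have ps6 : (6 <= size ps)%N.
  by have -> : size ps = (s - 3)%N by []; lia.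
have [Q0 [Q1 [Q0ps Q1ps Q01]]] :
    exists P Q, [/\ P \in ps, Q \in ps & P != Q].
  move: uon ps6; case: (ps) => [|P [|Q t]] //= /andP[].
  rewrite inE negb_or => /andP[PQ _] _ _.
  by exists P, Q; rewrite !inE !eqxx orbT.
have LE : val L = (val Q0 + val Q1)%VS.
  by apply: line_join => //; [move: Q0ps|move: Q1ps]; rewrite psE => /andP[].
have offL S : S \in [:: A0; A1; A2] -> ~~ (val S <= val Q0 + val Q1)%VS.
  by move=> /Aoff[_]; rewrite /on_line LE.
have Q01A : ~~ (val A0 <= val Q0 + val Q1)%VS by apply: offL; rewrite mem_head.
pose E := frame Q0 Q1 A0; pose A := frame A0 A1 A2.
have qs_line : points_on_line E (map (@repr k) ps).
  apply: points_on_line_frame => // S.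
  by rewrite psE /on_line LE => /andP[].
have rowA i : exists2 S, S \in [:: A0; A1; A2] & row i A = repr S.
  exists (tnth [tuple A0; A1; A2] i); first exact: mem_tnth.
  apply/rowP => j; rewrite !mxE.
  by case: i => [[|[|[|//]]] hi].
have rowA' S : S \in [:: A0; A1; A2] -> exists i, row i A = repr S.
  have [r0 r1 r2] := row_frame A0 A1 A2.
  by rewrite !inE => /or3P[] /eqP->; [exists 0|exists 1|exists ord_max].
have A_off i : (dual_coord E ord_max).@[fun j => row i A 0 j] != 0.
  have [S /offL SA ->] := rowA i.
  by move: SA; rewrite reprE -memvE (frame_line _ Q01 Q01A).
apply: (not_VV_torsion_free (frame_unit Q01 Q01A) qs_line
         (frame_unit A01 A012) A_off); rewrite ?size_map //.
- exact: jacobian_ideal_ideal.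
- exact: jacobian_ideal_sub.
- move=> d p hp p_on p_off; apply: ideal_gen_mem; split; first by exists d.
  move=> S SX; apply/(vanishes_repr _ hp).
  have [SL|SL] := boolP (on_line S L).
    by apply/p_on/map_f; rewrite psE SX.
  have [|i <-] := rowA' S; last exact: p_off.
  rewrite -offE; suff : S \in points_off X L by [].
  by rewrite !inE SX.
- exact: jacobian_bracket.
- move=> K idK KJ; apply: ideal_gen_sub => // p [[d hp] pX].
  apply: (KJ d p hp) => _ /mapP[S Sps ->].
  by apply/(vanishes_repr _ hp)/pX; move: Sps; rewrite psE => /andP[].
- exact: jacobian_ideal_min.
Qed.
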